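(* Let $\mathbf A\in\mathcal B_1^+(\mathcal H)$, let $\mathcal H_1=\overline{\mathcal R(\mathbf A)}$, let $\mathbf T:\mathcal R(\mathbf A^{1/2})\subset\mathcal H_1\to\mathcal H$ be an unbounded operator, and let $X\sim N_{\mathcal H}(\mathbf 0,\mathbf A)$. If $\mathbf T\mathbf A^{1/2}\in\mathcal B_2(\mathcal H)$, then there exists an extension $\tilde{\mathbf T}:\mathcal V\to\mathcal H$ of $\mathbf T$ such that $\mathcal V$ has full $N_{\mathcal H}(\mathbf 0,\mathbf A)$-measure. In this case, $$(\tilde{\mathbf T}X,X)\sim N_{\mathcal H\times\mathcal H}\big(\mathbf 0,(\mathbf T\mathbf A^{1/2},\mathbf A^{1/2})(\mathbf T\mathbf A^{1/2},\mathbf A^{1/2})^*\big).$$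
   Context: $\mathcal H$ is an infinite-dimensional separable real Hilbert space. $\mathcal B_1^+(\mathcal H)$ is the set of self-adjoint positive semidefinite trace-class operators; $\mathcal B_2(\mathcal H)$ the Hilbert–Schmidt operators; $\mathcal R$ denotes range. $N_{\mathcal H}(\mathbf 0,\mathbf A)$ is the centered Gaussian measure on $\mathcal H$ with covariance operator $\mathbf A$. ''Unbounded operator'' means a linear operator with dense domain (here $\mathcal R(\mathbf A^{1/2})$, dense in $\mathcal H_1$), not necessarily bounded or closable. An extension of $\mathbf T$ is a linear operator whose graph contains the graph of $\mathbf T$; here $\mathcal V\subset\mathcal H$ is a linear subspace. $(\mathbf T\mathbf A^{1/2},\mathbf A^{1/2}):\mathcal H\to\mathcal H\times\mathcal H$ is the operator $h\mapsto(\mathbf T\mathbf A^{1/2}h,\mathbf A^{1/2}h)$. *)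

(* Defs.v *)
From mathcomp Require Import all_boot all_order all_algebra.
From mathcomp Require Import all_classical all_reals all_analysis.

Set Implicit Arguments.
Unset Strict Implicit.
Unset Printing Implicit Defensive.

Import Order.TTheory GRing.Theory Num.Theory.
Import numFieldNormedType.Exports.

Local Open Scope classical_set_scope.
Local Open Scope ring_scope.

Notation borel E := (g_sigma_algebraType (@open E)).

Definition inner_product (R : realType) (E : lmodType R) (dot : E -> E -> R) :=
  [/\ forall x y, dot x y = dot y x,
      forall (a : R) x y z, dot (a *: x + y) z = a * dot x z + dot y z &
      forall x, x != 0 -> 0 < dot x x].

(* Completeness is part of the type of H. *)
Definition hilbert (R : realType) (H : completeNormedModType R)
    (dot : H -> H -> R) :=
  inner_product dot /\ forall x, dot x x = `|x| ^+ 2.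

Definition separable (T : topologicalType) :=
  exists2 D : set T, countable D & dense D.

Definition infinite_dimensional (R : realType) (E : lmodType R) :=
  forall (n : nat) (b : 'I_n -> E),
    exists x, forall c : 'I_n -> R, x <> \sum_(i < n) c i *: b i.

(* The inner product of the Hilbert space E x F.  The library's norm on the
   product type is the maximum of the two norms; [prod_dot_norm] below shows
   that the Hilbert norm is equivalent to it, so that both have the same
   topology and the same Borel sets. *)
Definition prod_dot (R : realType) (E F : lmodType R)
    (dotE : E -> E -> R) (dotF : F -> F -> R) (u v : E * F) : R :=
  dotE u.1 v.1 + dotF u.2 v.2.

Lemma prod_dot_inner_product (R : realType) (E F : lmodType R)
    (dotE : E -> E -> R) (dotF : F -> F -> R) :
  inner_product dotE -> inner_product dotF ->
  inner_product (prod_dot dotE dotF).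
Proof.
move=> [sE lE pE] [sF lF pF].
have n0 (G : lmodType R) (f : G -> G -> R) : inner_product f ->
    forall x, 0 <= f x x.
  move=> [_ l p] x; have [->|/p/ltW//] := eqVneq x 0.
  have := l 1 0 0 0; rewrite scaler0 addr0 mul1r => h.
  have -> : f 0 0 = 0 by apply: (addrI (f 0 0)); rewrite addr0 -h.
  by [].
split.
- by move=> x y; rewrite /prod_dot sE sF.
- by move=> a x y z; rewrite /prod_dot /= lE lF mulrDr addrACA.
- move=> [x y] xy; rewrite /prod_dot /=.
  have [x0|/pE x0] := eqVneq x 0.
    rewrite ltr_wpDl ?n0// pF//; apply: contraNneq xy => y0.
    by rewrite x0 y0.
  by rewrite ltr_pwDl ?n0.
Qed.

Lemma prod_dot_norm (R : realType) (H : completeNormedModType R)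
    (dot : H -> H -> R) (u : H * H) : hilbert dot ->
  `|u| ^+ 2 <= prod_dot dot dot u u <= 2 * `|u| ^+ 2.
Proof.
move=> [_ dotn]; rewrite /prod_dot !dotn.
have -> : `|u| = Num.max `|u.1| `|u.2| by [].
have sq (x y : R) : 0 <= x -> x <= y -> x ^+ 2 <= y ^+ 2.
  by move=> x0 xy; rewrite ler_sqr ?nnegrE// (le_trans x0).
rewrite mulrDl mul1r; apply/andP; split.
  by case: (leP `|u.1| `|u.2|) => _; rewrite ?lerDl ?lerDr sqr_ge0.
by rewrite lerD// sq// le_max lexx ?orbT.
Qed.

Definition bounded_operator (R : realType) (E F : normedModType R)
    (K : E -> F) := linear K /\ continuous K.

(* The adjoint of a bounded operator between Hilbert spaces; the vector chosen
   at y exists by the Riesz representation theorem and is unique. *)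
Definition adj (R : realType) (E F : lmodType R)
    (dotE : E -> E -> R) (dotF : F -> F -> R) (K : E -> F) (y : F) : E :=
  xget 0 [set z | forall x, dotF (K x) y = dotE x z].

Definition positive_semidefinite (R : realType) (E : lmodType R)
    (dot : E -> E -> R) (A : E -> E) :=
  (forall x y, dot (A x) y = dot x (A y)) /\ (forall x, 0 <= dot (A x) x).

(* S = A^{1/2}: the bounded positive square root, which is unique, and exists
   when A is bounded and positive on a Hilbert space. *)
Definition is_sqrt (R : realType) (H : normedModType R)
    (dot : H -> H -> R) (A S : H -> H) :=
  [/\ bounded_operator S, positive_semidefinite dot S & S \o S = A].

Definition orthonormal_basis (R : realType) (H : normedModType R)
    (dot : H -> H -> R) (e : nat -> H) :=
  (forall i j, dot (e i) (e j) = (i == j)%:R) /\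
  (forall x, (fun n => \sum_(0 <= i < n) dot x (e i) *: e i) @ \oo --> x).

(* |A| = (A^* A)^{1/2} has finite trace.  The value of the trace does not
   depend on the orthonormal basis; the same holds for the sum in
   [hilbert_schmidt]. *)
Definition trace_class (R : realType) (H : normedModType R)
    (dot : H -> H -> R) (A : H -> H) :=
  bounded_operator A /\
  exists absA : H -> H, is_sqrt dot (adj dot dot A \o A) absA /\
  exists e : nat -> H, orthonormal_basis dot e /\
    (\sum_(0 <= n <oo) (dot (absA (e n)) (e n))%:E < +oo)%E.

Definition hilbert_schmidt (R : realType) (H : normedModType R)
    (dot : H -> H -> R) (K : H -> H) :=
  bounded_operator K /\
  exists e : nat -> H, orthonormal_basis dot e /\
    (\sum_(0 <= n <oo) (`|K (e n)| ^+ 2)%:E < +oo)%E.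

(* An operator with domain D is a total function of which only the values
   on D matter. *)
Definition linear_subspace (R : realType) (E : lmodType R) (D : set E) :=
  D 0 /\ forall (a : R) x y, D x -> D y -> D (a *: x + y).

Definition linear_on (R : realType) (E F : lmodType R)
    (D : set E) (T : E -> F) :=
  linear_subspace D /\
  forall (a : R) x y, D x -> D y -> T (a *: x + y) = a *: T x + T y.

Definition unbounded_operator (R : realType) (H : normedModType R)
    (H1 D : set H) (T : H -> H) :=
  [/\ linear_on D T, D `<=` H1 & H1 `<=` closure D].

Definition graph (E F : Type) (D : set E) (T : E -> F) : set (E * F) :=
  [set (x, T x) | x in D].

Definition extension (R : realType) (E F : lmodType R)
    (V : set E) (T' : E -> F) (D : set E) (T : E -> F) :=
  linear_on V T' /\ graph D T `<=` graph V T'.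

(* The value 0 off V is irrelevant once V has full measure. *)
Definition on_domain (E : Type) (F : nmodType) (V : set E) (T : E -> F)
    (x : E) : F := if x \in V then T x else 0.

(* N(m, v) on the real line, v being the variance; the library's
   [normal_prob] is parametrized by the standard deviation and is a normal
   law only when it is nonzero. *)
Definition normal_law (R : realType) (m v : R) (B : set R) : \bar R :=
  if v == 0 then \d_m B else normal_prob m (Num.sqrt v) B.

(* mu = N_E(m, C): every functional <., h> has law N(<m, h>, <C h, h>). *)
Definition gaussian_measure (R : realType) (E : normedModType R)
    (dot : E -> E -> R) (mu : set (borel E) -> \bar R)
    (m : E) (C : E -> E) :=
  positive_semidefinite dot C /\
  forall (h : E) (B : set R), measurable B ->
    mu [set x | B (dot x h)] = normal_law (dot m h) (dot (C h) h) B.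

Definition gaussian_rv (R : realType) (E : normedModType R)
    (dot : E -> E -> R) (d : measure_display) (Omega : measurableType d)
    (P : probability Omega R) (X : Omega -> E) (m : E) (C : E -> E) :=
  measurable_fun [set: Omega] (X : Omega -> borel E) /\
  gaussian_measure dot (pushforward P (X : Omega -> borel E)) m C.

(* Main.v *)
(** The operator [L = T o S], with [S = A^(1/2)], is Hilbert-Schmidt and vanishes
    on the kernel of [S]; hence each [L^* e_i] lies in the closure of the range
    of [S], and there are finitely many vectors [g_(n,i)] with
    [sum_i |S g_(n,i) - L^* e_i|^2 <= 4^-(n+1)].  The finite-rank operators
    [T_n x = sum_i <x, g_(n,i)> e_i] are continuous and [T_n S -> L] pointwise.
    Under N(0, A) the variable [<x, k>] has variance [|S k|^2], so the increments
    [T_(n+1) x - T_n x] have geometrically small second moments and [T_n x]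
    converges almost surely.  The extension is the pointwise limit of the [T_n]
    on the linear space [V] where they converge; it agrees with [T] on the range
    of [S].  For the joint law, [<T' x, h1> + <x, h2>] is an almost sure limit of
    variables [<x, k_n>] with [S k_n -> L^* h1 + S h2]. *)
From HB Require Import structures.
Require Import Defs.
From mathcomp Require Import all_boot all_order all_algebra.
From mathcomp Require Import all_classical all_reals all_analysis.
From mathcomp Require Import measurable_realfun ring lra.

Import Order.TTheory GRing.Theory Num.Theory.
Import numFieldNormedType.Exports.

Local Open Scope classical_set_scope.
Local Open Scope ring_scope.

Set Implicit Arguments.
Unset Strict Implicit.
Unset Printing Implicit Defensive.

(** * Hilbert spaces *)

Lemma cvg_ge_all (R : realType) (u : nat -> R) l c :
  u @ \oo --> l -> (forall n, c <= u n) -> c <= l.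
Proof.
move=> ul cu; rewrite -(cvg_lim (@Rhausdorff R) ul).
by apply: limr_ge; [apply/cvg_ex; exists l|exact: nearW].
Qed.

Lemma cvg_le_all (R : realType) (u : nat -> R) l c :
  u @ \oo --> l -> (forall n, u n <= c) -> l <= c.
Proof.
move=> ul cu; rewrite -(cvg_lim (@Rhausdorff R) ul).
by apply: limr_le; [apply/cvg_ex; exists l|exact: nearW].
Qed.

Lemma cvg_sqr_norm (R : realType) (V : normedModType R) (T : Type)
    (F : set_system T) {FF : Filter F} (u : T -> V) (l : V) :
  u @ F --> l -> `|u t| ^+ 2 @[t --> F] --> `|l| ^+ 2.
Proof.
move=> ul; exact: (cvg_comp _ (fun t : R => t ^+ 2) (cvg_norm ul)
  (@exprn_continuous R 2 `|l|)).
Qed.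

Section linear_functions.
Context (R : realType) (E F : lmodType R) (f : E -> F) (linf : linear f).

Lemma linear_funD x y : f (x + y) = f x + f y.
Proof. by rewrite -[x]scale1r linf !scale1r. Qed.

Lemma linear_fun0 : f 0 = 0.
Proof. by apply: (addrI (f 0)); rewrite -linear_funD !addr0. Qed.

Lemma linear_funZ a x : f (a *: x) = a *: f x.
Proof. by rewrite -[a *: x]addr0 linf linear_fun0 addr0. Qed.

Lemma linear_funB x y : f (x - y) = f x - f y.
Proof. by rewrite linear_funD -scaleN1r linear_funZ scaleN1r. Qed.

Lemma linear_fun_sum (I : Type) (s : seq I) (P : pred I) (G : I -> E) :
  f (\sum_(i <- s | P i) G i) = \sum_(i <- s | P i) f (G i).
Proof. by apply: big_morph; [exact: linear_funD|exact: linear_fun0]. Qed.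

End linear_functions.

Section inner_product_theory.
Context (R : realType) (H : completeNormedModType R) (dot : H -> H -> R).
Context (Hdot : hilbert dot).
Implicit Types (x y z : H) (a : R).

Lemma dotC x y : dot x y = dot y x.
Proof. by case: Hdot => -[]. Qed.

Lemma dotP a x y z : dot (a *: x + y) z = a * dot x z + dot y z.
Proof. by case: Hdot => -[]. Qed.

Lemma dotxx x : dot x x = `|x| ^+ 2.
Proof. by case: Hdot. Qed.

Lemma dotDl x y z : dot (x + y) z = dot x z + dot y z.
Proof. by rewrite -[x]scale1r dotP mul1r scale1r. Qed.

Lemma dot0l z : dot 0 z = 0.
Proof. by apply: (addrI (dot 0 z)); rewrite -dotDl !addr0. Qed.

Lemma dotZl a x z : dot (a *: x) z = a * dot x z.
Proof. by rewrite -[a *: x]addr0 dotP dot0l addr0. Qed.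

Lemma dotNl x z : dot (- x) z = - dot x z.
Proof. by rewrite -scaleN1r dotZl mulN1r. Qed.

Lemma dotBl x y z : dot (x - y) z = dot x z - dot y z.
Proof. by rewrite dotDl dotNl. Qed.

Lemma dotDr x y z : dot z (x + y) = dot z x + dot z y.
Proof. by rewrite !(dotC z) dotDl. Qed.

Lemma dot0r z : dot z 0 = 0.
Proof. by rewrite dotC dot0l. Qed.

Lemma dotZr a x z : dot z (a *: x) = a * dot z x.
Proof. by rewrite !(dotC z) dotZl. Qed.

Lemma dotBr x y z : dot z (x - y) = dot z x - dot z y.
Proof. by rewrite !(dotC z) dotBl. Qed.

Lemma dot_suml (I : Type) (s : seq I) (P : pred I) (F : I -> H) y :
  dot (\sum_(i <- s | P i) F i) y = \sum_(i <- s | P i) dot (F i) y.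
Proof. by apply: (big_morph (dot ^~ y)) => [u v|]; rewrite ?dotDl ?dot0l. Qed.

Lemma dot_sumr (I : Type) (s : seq I) (P : pred I) (F : I -> H) y :
  dot y (\sum_(i <- s | P i) F i) = \sum_(i <- s | P i) dot y (F i).
Proof. by rewrite dotC dot_suml; apply: eq_bigr => i _; rewrite dotC. Qed.

Lemma dot_inj x y : (forall z, dot z x = dot z y) -> x = y.
Proof.
move=> xy; apply/eqP; rewrite -subr_eq0 -normr_eq0 -sqrf_eq0 -dotxx dotBr.
by rewrite xy subrr.
Qed.

Lemma sqr_normD x y : `|x + y| ^+ 2 = `|x| ^+ 2 + 2 * dot x y + `|y| ^+ 2.
Proof. by rewrite -!dotxx dotDl !dotDr (dotC y x); ring. Qed.

Lemma sqr_normB x y : `|x - y| ^+ 2 = `|x| ^+ 2 - 2 * dot x y + `|y| ^+ 2.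
Proof. by rewrite -!dotxx dotBl !dotBr (dotC y x); ring. Qed.

Lemma sqr_norm_add_le x y : `|x + y| ^+ 2 <= 2 * `|x| ^+ 2 + 2 * `|y| ^+ 2.
Proof.
by have := sqr_ge0 `|x - y|; rewrite sqr_normB sqr_normD; lra.
Qed.

Lemma cauchy_schwarz x y : `|dot x y| <= `|x| * `|y|.
Proof.
have [->|y0] := eqVneq y 0; first by rewrite dot0r !normr0 mulr0.
have y2 : 0 < `|y| ^+ 2 by rewrite exprn_gt0// normr_gt0.
rewrite -ler_sqr ?nnegrE ?mulr_ge0// exprMn real_normK ?num_real//.
have := sqr_ge0 `|x - (dot x y / `|y| ^+ 2) *: y|.
rewrite sqr_normB dotZr normrZ exprMn real_normK ?num_real// => h.
rewrite -subr_ge0 -(pmulr_rge0 _ (_ : 0 < (`|y| ^+ 2)^-1)) ?invr_gt0//.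
apply: le_trans h _; rewrite le_eqVlt; apply/orP; left; apply/eqP; field.
by rewrite lt0r_neq0 ?normr_gt0.
Qed.

Lemma continuous_dotl y : continuous (dot ^~ y).
Proof.
move=> x; apply/(@cvgrPdist_le _ R^o) => e e0; near=> z.
rewrite -dotBl; apply: le_trans (cauchy_schwarz _ _) _.
have : `|x - z| * (`|y| + 1) <= e.
  rewrite -ler_pdivlMr ?ltr_wpDl//; near: z.
  by apply: (@cvgr_dist_le _ _ _ _ _ idfun) => //; rewrite divr_gt0// ltr_wpDl.
by apply: le_trans; rewrite ler_wpM2l// lerDl.
Unshelve. all: by end_near. Qed.

Lemma cvg_dotl (T : Type) (F : set_system T) {FF : Filter F} (f : T -> H) x y :
  f @ F --> x -> dot (f t) y @[t --> F] --> dot x y.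
Proof.
by move=> fx; apply: (cvg_comp f (dot ^~ y) fx); exact: continuous_dotl.
Qed.

Lemma cvg_dotr (T : Type) (F : set_system T) {FF : Filter F} (f : T -> H) x y :
  f @ F --> x -> dot y (f t) @[t --> F] --> dot y x.
Proof.
by move=> fx; under eq_fun do rewrite dotC; rewrite dotC; exact: cvg_dotl.
Qed.

(** The additive bound fits both a minimizing sequence, with [b n = 2 / (n + 1)], and an orthonormal
    series, with [b n] the distance from the partial sum of squares to its limit. *)
Lemma cauchy_sqr_cvg (u : nat -> H) (b : nat -> R) :
  b @ \oo --> 0 -> (forall n m, `|u n - u m| ^+ 2 <= b n + b m) -> cvgn u.
Proof.
move=> b0 ub; apply/cauchy_cvgP/cauchyP => e e0.
have : \forall n \near \oo, `|0 - b n| < e ^+ 2 / 2.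
  by apply: cvgr_dist_lt => //; rewrite divr_gt0// exprn_gt0.
move=> [N _ bN]; exists (u N); exists N => // n /= Nn.
rewrite -ball_normE/= -ltr_sqr ?nnegrE ?(ltW e0)//.
apply: le_lt_trans (ub _ _) _.
have := bN _ Nn; have := bN N (leqnn N); rewrite /= !sub0r !normrN.
by have := ler_norm (b n); have := ler_norm (b N); lra.
Qed.

(* The residuals [z - S (g n)] of a minimizing sequence are Cauchy by the
   parallelogram identity, and their limit is orthogonal to the range of [S],
   hence lies in the kernel of [S]. *)
Lemma closure_range_symmetric (S : H -> H) (z : H) : linear S ->
  (forall x y, dot (S x) y = dot x (S y)) ->
  (forall x, S x = 0 -> dot z x = 0) ->
  forall e, 0 < e -> exists g, `|z - S g| < e.
Proof.
move=> linS symS zS e e0.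
have SD := linear_funD linS; have SZ := linear_funZ linS.
pose D := range (fun g => `|z - S g| ^+ 2).
have D0 : has_inf D.
  split; first by exists (`|z - S 0| ^+ 2), 0.
  by exists 0 => _ [g _ <-]; exact: sqr_ge0.
pose d := inf D.
have dle g : d <= `|z - S g| ^+ 2 by apply: ge_inf; [case: D0|exists g].
have /choice[g gP] n : exists g, `|z - S g| ^+ 2 < d + n.+1%:R^-1.
  have /(inf_adherent) : (0 : R) < n.+1%:R^-1 by [].
  by move=> /(_ D D0)[_ [g _ <-] h]; exists g.
pose r n := z - S (g n).
have rle n m : `|r n - r m| ^+ 2 <= 2 * (n.+1%:R^-1 + m.+1%:R^-1).
  (* Minimality is tested at the midpoint of [g n] and [g m], whose residual is the midpoint of
     [r n] and [r m]. *)
  have := gP n; have := gP m; have := dle (2^-1 *: (g n + g m)).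
  have -> : z - S (2^-1 *: (g n + g m)) = 2^-1 *: (r n + r m).
    rewrite SZ SD /r addrACA -opprD scalerBr; congr (_ - _).
    by rewrite -mulr2n -[z *+ 2]scaler_nat scalerA mulVf ?scale1r ?pnatr_eq0.
  rewrite -/(r n) -/(r m); move: (r n) (r m) => u v.
  rewrite normrZ exprMn ger0_norm// (sqr_normB u v) sqr_normD.
  have -> : (2^-1 : R) ^+ 2 = 4^-1 by rewrite exprVn; congr (_^-1); ring.
  by move: n.+1%:R^-1 m.+1%:R^-1 => p q; lra.
have rc : cvgn r.
  apply: (@cauchy_sqr_cvg _ (fun n => 2 * n.+1%:R^-1)) => [|n m].
    rewrite -(mulr0 2); apply: cvgMr => //; exact: cvg_harmonic.
  by rewrite -mulrDr.
have rle_lim y : (forall n, d <= `|r n - y| ^+ 2) -> d <= `|limn r - y| ^+ 2.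
  by apply: cvg_ge_all; apply: cvg_sqr_norm; apply: cvgB => //; exact: cvg_cst.
have rd : `|limn r| ^+ 2 <= d.
  apply: (@cvg_le_all _ (fun n => `|r n| ^+ 2 - n.+1%:R^-1)) => [|n];
    last first.
    by rewrite lerBlDr; exact: ltW (gP n).
  rewrite -[X in _ --> X]subr0; apply: cvgB; last exact: cvg_harmonic.
  exact: cvg_sqr_norm.
have orth h : dot (limn r) (S h) = 0.
  set p := dot _ _; have [//|p0] := eqVneq p 0.
  (* The 1 keeps the denominator of [t] positive for every [h]. A step of [t] along [S h] would give
     [2 t^2 (1 + |S h|^2) <= t^2 |S h|^2], which is false for nonzero [t]. *)
  have m0 : 0 < 1 + `|S h| ^+ 2 by rewrite ltr_wpDr ?sqr_ge0.
  pose t := p / (1 + `|S h| ^+ 2).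
  have : d <= `|limn r - t *: S h| ^+ 2.
    apply: rle_lim => n; rewrite /r -addrA -opprD -SZ -SD; exact: dle.
  rewrite sqr_normB dotZr -/p normrZ exprMn real_normK ?num_real// => dr.
  have tp : t * (1 + `|S h| ^+ 2) = p by rewrite divfK ?gt_eqF.
  have : 0 < t ^+ 2 by rewrite exprn_even_gt0//= mulf_neq0// invr_neq0// gt_eqF.
  have : t * (t * (1 + `|S h| ^+ 2)) = t * p by rewrite tp.
  have := sqr_ge0 `|S h|; have := sqr_ge0 t.
  move: dr rd; move: (`|S h| ^+ 2) => q; nra.
have Sr : S (limn r) = 0.
  apply: dot_inj => h; rewrite dot0r dotC symS; exact: orth.
(* Being in the kernel of [S], the limit is orthogonal to [z] and to every [S (g n)], hence to every
   [r n], and so to itself. *)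
have : dot (limn r) (limn r) <= 0.
  apply: (@cvg_le_all _ (fun n => dot (r n) (limn r))); first exact: cvg_dotl.
  by move=> n; rewrite /r dotBl symS Sr dot0r zS ?subr0.
rewrite dotxx => r0; have {}r0 : limn r = 0.
  by apply/eqP; rewrite -normr_eq0 -sqrf_eq0 eq_le sqr_ge0 andbT.
have : \forall n \near \oo, `|0 - r n| < e.
  by apply: cvgr_dist_lt => //; rewrite -r0.
by move=> /filter_ex[n]; rewrite sub0r normrN; exists (g n).
Qed.

(** * Orthonormal expansions and adjoints of Hilbert-Schmidt operators *)

Section orthonormal.
Context (e : nat -> H) (He : orthonormal_basis dot e).

Lemma sqr_norm_sum_orthonormal (c : nat -> R) m n :
  `|\sum_(m <= i < n) c i *: e i| ^+ 2 = \sum_(m <= i < n) c i ^+ 2.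
Proof.
rewrite -dotxx dot_suml; apply: eq_big_seq => i im.
rewrite dotZl dot_sumr (bigD1_seq i) ?iota_uniq//= dotZr He.1 eqxx mulr1.
rewrite big1 ?addr0 ?expr2// => j ji.
by rewrite dotZr He.1 eq_sym (negbTE ji) mulr0.
Qed.

Lemma bessel x n : \sum_(0 <= i < n) dot x (e i) ^+ 2 <= `|x| ^+ 2.
Proof.
have := sqr_ge0 `|x - \sum_(0 <= i < n) dot x (e i) *: e i|.
rewrite sqr_normB sqr_norm_sum_orthonormal dot_sumr.
under [X in 2 * X]eq_bigr do rewrite dotZr -expr2.
lra.
Qed.

Lemma parseval x :
  (fun n => \sum_(0 <= i < n) dot x (e i) ^+ 2) @ \oo --> `|x| ^+ 2.
Proof.
under eq_fun do rewrite -sqr_norm_sum_orthonormal.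
by apply: cvg_sqr_norm; exact: He.2.
Qed.

(** By Pythagoras the squared distance between two partial sums is a difference of partial sums of
    [c i ^+ 2], and these converge by monotonicity. *)
Lemma orthonormal_series_cvg (c : nat -> R) C :
  (forall n, \sum_(0 <= i < n) c i ^+ 2 <= C) ->
  cvgn (fun n => \sum_(0 <= i < n) c i *: e i).
Proof.
move=> cC; pose s n := \sum_(0 <= i < n) c i ^+ 2.
have sc : cvgn s.
  apply: nondecreasing_is_cvgn; last by exists C => _ [n _ <-]; exact: cC.
  apply/nondecreasing_seqP => n; rewrite /s big_nat_recr//= lerDl sqr_ge0 //.
apply: (@cauchy_sqr_cvg _ (fun n => `|limn s - s n|)) => [|n m].
  have -> : 0 = `|limn s - limn s| by rewrite subrr normr0.
  by apply: cvg_norm; apply: cvgB => //; exact: cvg_cst.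
wlog nm : n m / (n <= m)%N.
  move=> h; have [/h//|/ltnW/h] := leqP n m.
  by move=> {}h; rewrite distrC [leRHS]addrC.
rewrite distrC (big_cat_nat (leq0n n) nm)//= [_ + _ - _]addrC addKr.
rewrite sqr_norm_sum_orthonormal.
have -> : \sum_(n <= i < m) c i ^+ 2 = s m - s n.
  by rewrite /s (big_cat_nat (leq0n n) nm)//= [RHS]addrC addKr.
have := ler_norm (limn s - s n); have := ler_norm (s m - limn s).
by rewrite distrC; lra.
Qed.

Section adjoint.
Context (K : H -> H) (Kb : bounded_operator K) (C : R).
Context (KC : forall n, \sum_(0 <= i < n) `|K (e i)| ^+ 2 <= C).

(** The adjoint is given by its expansion [sum_i <K e_i, y> e_i], which converges by Cauchy-Schwarz
    and the Hilbert-Schmidt bound. The identity holds for the truncations of [x] by linearity and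
    passes to the limit by continuity of [K]. *)
Lemma hilbert_schmidt_adjoint :
  exists Ka : H -> H, forall x y, dot (K x) y = dot x (Ka y).
Proof.
have Kc y : cvgn (fun n => \sum_(0 <= i < n) dot (K (e i)) y *: e i).
  apply: (@orthonormal_series_cvg _ (C * `|y| ^+ 2)) => n.
  apply: le_trans (ler_wpM2r (sqr_ge0 _) (KC n)).
  rewrite mulr_suml; apply: ler_sum => i _.
  rewrite -exprMn -real_normK ?num_real// ler_sqr ?nnegrE ?mulr_ge0//.
  exact: cauchy_schwarz.
exists (fun y => limn (fun n => \sum_(0 <= i < n) dot (K (e i)) y *: e i)).
move=> x y; case: Kb => linK contK.
have l2 : dot x (\sum_(0 <= i < n) dot (K (e i)) y *: e i) @[n --> \oo] -->
    dot x (limn (fun n => \sum_(0 <= i < n) dot (K (e i)) y *: e i)).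
  by apply: cvg_dotr; exact: Kc.
have KP n : dot (K (\sum_(0 <= i < n) dot x (e i) *: e i)) y =
            dot x (\sum_(0 <= i < n) dot (K (e i)) y *: e i).
  rewrite dot_sumr (linear_fun_sum linK) dot_suml; apply: eq_bigr => i _.
  by rewrite dotZr (linear_funZ linK) dotZl mulrC.
have : dot (K (\sum_(0 <= i < n) dot x (e i) *: e i)) y @[n --> \oo] -->
    dot (K x) y.
  by apply: cvg_dotl; apply: (cvg_comp _ K (He.2 x)); exact: contK.
under eq_fun do rewrite KP.
by move=> l1; exact: (cvg_unique (@Rhausdorff R) l1 l2).
Qed.

(** The double sum of [<K e_j, e_i>^2] is read in both orders: Parseval in [j] recovers the norms of
    [Ka (e i)], and Bessel in [i] bounds it by the norms of [K (e j)]. *)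
Lemma hilbert_schmidt_adjoint_le (Ka : H -> H) :
  (forall x y, dot (K x) y = dot x (Ka y)) ->
  forall n, \sum_(0 <= i < n) `|Ka (e i)| ^+ 2 <= C.
Proof.
move=> KKa n.
apply: (@cvg_le_all _ (fun m =>
  \sum_(0 <= i < n) \sum_(0 <= j < m) dot (Ka (e i)) (e j) ^+ 2)) => [|m].
  by apply: cvg_big => [|i _]; [exact: add_continuous|exact: parseval].
rewrite exchange_big; apply: le_trans (KC m); apply: ler_sum => j _ /=.
apply: le_trans (bessel (K (e j)) n).
by under [leRHS]eq_bigr do rewrite KKa dotC.
Qed.

End adjoint.
End orthonormal.
End inner_product_theory.

(** * Laws on the real line *)

(** Complements reverse the inequality on closed sets. Closed rays are closed and also decreasing
    limits of open rays, so both inequalities hold on them, and they form a generating family stable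
    under intersection. *)
Lemma eq_probability_open_le (R : realType)
    (m nu : probability (measurableTypeR R) R) :
  (forall U : set R, open U -> (m U <= nu U)%E) ->
  forall B : set R, measurable B -> m B = nu B.
Proof.
move=> mnu; have closed_ge (C : set R) : measurable C -> closed C ->
    (nu C <= m C)%E.
  move=> mC cC; have := mnu _ (closed_openC cC).
  rewrite !probability_setC//.
  rewrite -(fineK (fin_num_measure m C mC)) -(fineK (fin_num_measure nu C mC)).
  by rewrite -!EFinB !lee_fin; lra.
move=> B mB.
apply: (@measure_unique _ R (measurableTypeR R) (@RGenCInfty.G R)
  (fun n => `[- n%:R, +oo[%classic)) => //.
- exact: RGenCInfty.measurableE.
- move=> _ _ [x ->] [y ->]; exists (Num.max x y).
  apply/seteqP; split=> z /=; rewrite !in_itv/= !andbT ge_max.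
    by move=> [-> ->].
  by move=> /andP[-> ->].
- by move=> n; exists (- n%:R).
- apply/seteqP; split=> // x _; exists (Num.truncn `|x|).+1 => //=.
  rewrite in_itv/= andbT lerNl (le_trans (ler_norm _))// normrN ltW//.
  exact: truncnS_gt.
- move=> _ [x ->]; apply/eqP; rewrite eq_le closed_ge// ?andbT; last first.
    exact: interval_closed.
  have: nu `]x - n.+1%:R^-1, +oo[%classic @[n --> \oo] --> nu `[x, +oo[%classic.
    rewrite itvcyEbigcap; apply: nonincreasing_cvg_mu => //.
    - by apply: le_lt_trans (probability_le1 nu _) (ltry _).
    - by rewrite -itvcyEbigcap.
    - move=> p q pq; apply/subsetPset => z /=; rewrite !in_itv/= !andbT.
      by apply: le_lt_trans; rewrite lerB// lef_pV2 ?posrE// ler_nat.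
  move=> nucvg; have nulim := cvg_lim (@ereal_hausdorff R) nucvg.
  apply: (@le_trans _ _ (limn (fun n => nu `]x - n.+1%:R^-1, +oo[%classic)));
    last by rewrite nulim.
  apply: lime_ge; first by apply/cvg_ex; eexists; exact: nucvg.
  apply: nearW => n; apply: le_trans (mnu _ _) => //.
  rewrite le_measure ?inE// => z /=; rewrite !in_itv/= !andbT.
  by apply: lt_le_trans; rewrite ltrBlDr ltrDl.
- by move=> k; apply: le_lt_trans (probability_le1 m _) (ltry _).
Qed.

(* Almost surely, [f x \in U] with [U] open forces [f_ n x \in U] eventually;
   comparing open sets is enough to identify two laws. *)
Lemma eq_distribution_cvg (R : realType) d (T : measurableType d)
    (mu : probability T R) (nu : probability (measurableTypeR R) R)
    (f_ : nat -> T -> R) (f : T -> R) :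
  (forall n, measurable_fun setT (f_ n)) -> measurable_fun setT f ->
  {ae mu, forall x, f_ n x @[n --> \oo] --> f x} ->
  (forall n (B : set R), measurable B -> mu (f_ n @^-1` B) = nu B) ->
  forall B : set R, measurable B -> mu (f @^-1` B) = nu B.
Proof.
move=> mf_ mf [N [mN N0 NP]] law.
pose mF := isMeasurableFun.Build _ _ T (measurableTypeR R) f mf.
pose F : {mfun T >-> measurableTypeR R} := HB.pack f mF.
pose m : probability (measurableTypeR R) R := distribution mu F.
suff mnu : forall B : set R, measurable B -> m B = nu B by exact: mnu.
apply: eq_probability_open_le => U oU.
have mU : measurable U by exact: open_measurable.
pose E n := \bigcap_(k in [set k | (n <= k)%N]) (f_ k @^-1` U).
have mE n : measurable (E n).
  apply: bigcap_measurable => [|k _]; first by exists n => /=.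
  by rewrite -[X in measurable X]setTI; exact: mf_.
have ndE : nondecreasing_seq E.
  move=> p q pq; apply/subsetPset => x Ex k /= qk; apply: Ex => /=.
  exact: leq_trans qk.
have fE : f @^-1` U `<=` \bigcup_n E n `|` N.
  move=> x /= fx; have [fcvg|nfcvg] := pselect (f_ n x @[n --> \oo] --> f x).
    left; have [n _ nU] : \forall n \near \oo, U (f_ n x).
      by apply: fcvg; exact: open_nbhs_nbhs.
    by exists n => // k /= nk; exact: nU.
  by right; exact: NP.
have mUE : measurable (\bigcup_n E n) by exact: bigcup_measurable.
apply: (@le_trans _ _ (mu (\bigcup_n E n `|` N))).
  change (mu (f @^-1` U) <= mu (\bigcup_n E n `|` N))%E.
  apply: le_measure; rewrite ?inE//; last exact: measurableU.
  by rewrite -[X in measurable X]setTI; exact: (mf measurableT _ mU).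
have Ecvg : mu (E n) @[n --> \oo] --> mu (\bigcup_n E n).
  exact: nondecreasing_cvg_mu mE mUE ndE.
apply: (@le_trans _ _ (limn (fun n => mu (E n)))).
  by rewrite measureU0// (cvg_lim (@ereal_hausdorff R) Ecvg).
apply: lime_le; first by apply/cvg_ex; eexists; exact: Ecvg.
apply: nearW => n /=; rewrite -(law n)//; apply: le_measure; rewrite ?inE//.
  by rewrite -[X in measurable X]setTI; exact: mf_.
by move=> x; apply => /=.
Qed.

(** The Radon-Nikodym derivative of the normal law and the explicit density have equal integrals
    over all measurable sets, hence agree almost everywhere. *)
Lemma ge0_integral_normal_prob (R : realType) (m s : R) (f : R -> \bar R) :
  measurable_fun [set: R] f -> (forall x, 0 <= f x)%E ->
  (\int[normal_prob m s]_x f x =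
   \int[lebesgue_measure]_x (f x * (normal_pdf m s x)%:E))%E.
Proof.
move=> mf f0.
rewrite -(@Radon_Nikodym_SigmaFinite.change_of_variables _ _ _
   (normal_prob m s) lebesgue_measure (normal_prob_dominates m s))//.
have dom := normal_prob_dominates m s.
apply: ae_eq_integral => //.
- apply: emeasurable_funM => //; apply: (measurable_int lebesgue_measure).
  exact: Radon_Nikodym_SigmaFinite.f_integrable.
- apply: emeasurable_funM => //; apply/measurable_EFinP.
  exact: measurable_normal_pdf.
- apply: ae_eqe_mul2l; apply: integral_ae_eq => //.
  + exact: Radon_Nikodym_SigmaFinite.f_integrable.
  + by apply/measurable_EFinP; exact: measurable_normal_pdf.
  + by move=> E _ mE; rewrite -Radon_Nikodym_SigmaFinite.f_integral.
Qed.

(* [x^2 / 4 <= exp (x^2 / 4)] turns the integrand into a multiple of the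
   density of N(0, 2). *)
Lemma normal_moment2_lty (R : realType) :
  (\int[@normal_prob R 0 1]_x (x ^+ 2)%:E < +oo)%E.
Proof.
have s2 : Num.sqrt 2 != 0 :> R by rewrite gt_eqF// sqrtr_gt0.
(* The factor 4 comes from [x^2 = 4 t] with [t = x^2 / 4]; the quotient exchanges the normalizing
   constants of N(0, 1) and N(0, 2). *)
pose c : R := 4 * normal_peak 1 / normal_peak (Num.sqrt 2).
have mx2 : measurable_fun [set: R] (fun x : R => (x ^+ 2)%:E).
  by apply/measurable_EFinP; exact: measurable_funX.
rewrite ge0_integral_normal_prob//; last by move=> x; rewrite lee_fin sqr_ge0.
apply: (@le_lt_trans _ _
  (\int[lebesgue_measure]_x (c%:E * (normal_pdf 0 (Num.sqrt 2) x)%:E))%E).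
  apply: ge0_le_integral => //.
  - by move=> x _; rewrite mule_ge0// lee_fin ?sqr_ge0// normal_pdf_ge0.
  - apply: emeasurable_funM => //; apply/measurable_EFinP.
    exact: measurable_normal_pdf.
  - apply: emeasurable_funM => //; apply/measurable_EFinP.
    exact: measurable_normal_pdf.
  - move=> x _; rewrite -!EFinM lee_fin !normal_pdfE// /c.
    rewrite mulrA [leRHS]mulrA divfK ?gt_eqF ?normal_peak_gt0//.
    pose t : R := x ^+ 2 / 4.
    have -> : normal_fun 0 (Num.sqrt 2) x = expR (- t).
      by rewrite /normal_fun subr0 sqr_sqrtr// /t mulNr -mulr_natr -natrM.
    have -> : normal_fun 0 1 x = expR (- t) * expR (- t).
      by rewrite /normal_fun subr0 -expRD; congr expR; rewrite /t; field.
    have -> : x ^+ 2 = 4 * t by rewrite /t; field.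
    rewrite [leLHS](_ : _ = 4 * normal_peak 1 * expR (- t) * (t * expR (- t)));
      last by ring.
    rewrite ler_piMr ?mulr_ge0 ?normal_peak_ge0 ?expR_ge0//.
    rewrite expRN ler_pdivrMr ?expR_gt0// mul1r.
    by apply: le_trans (expR_ge1Dx t); rewrite lerDr.
rewrite ge0_integralZl//.
- by rewrite integral_normal_pdf mule1 ltry.
- by apply/measurable_EFinP; exact: measurable_normal_pdf.
- by move=> x _; rewrite lee_fin normal_pdf_ge0.
- by rewrite lee_fin divr_ge0 ?mulr_ge0// normal_peak_ge0.
Qed.

(** * Borel sets and Gaussian functionals *)

Lemma open_borel (E : ptopologicalType) (U : set E) :
  open U -> measurable (U : set (borel E)).
Proof. exact: sub_sigma_algebra. Qed.

Lemma closed_borel (E : ptopologicalType) (U : set E) :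
  closed U -> measurable (U : set (borel E)).
Proof.
move=> cU; rewrite -[U]setCK; apply: measurableC.
by apply: open_borel; exact: closed_openC.
Qed.

Lemma continuous_borel_measurable (R : realType) (E : ptopologicalType)
    (f : E -> R) : continuous f -> measurable_fun [set: borel E] f.
Proof.
move=> /continuousP cf; apply: (measurability _ (RGenOpens.measurableE R)).
move=> _ [_ [a [b ->] <-]]; rewrite setTI; apply: open_borel.
exact/cf/interval_open.
Qed.

(** By separability an open set of the product is a countable union of boxes of balls with centres
    in the dense sets and radii [1 / (k + 1)], and the preimage of such a box is described by
    distances to the two centres. *)
Lemma measurable_borel_pair (R : realType) (E F : normedModType R)
    d (W : measurableType d) (f : W -> E) (g : W -> F) :
  separable E -> separable F ->
  (forall a, measurable_fun setT (fun w => `|f w - a|)) ->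
  (forall a, measurable_fun setT (fun w => `|g w - a|)) ->
  measurable_fun setT ((fun w => (f w, g w)) : W -> borel (E * F)%type).
Proof.
move=> [D cD dD] [D' cD' dD'] mf mg.
apply: (@measurability _ _ _ (borel (E * F)%type) setT _ open) => //.
move=> _ [U oU <-]; rewrite setTI.
pose r (k : nat) : R := k.+1%:R^-1.
pose box (p : D * D' * nat) :=
  ball (\val p.1.1) (r p.2) `*` ball (\val p.1.2) (r p.2).
(* All boxes index the union, which keeps it countable; a box not contained in [U] contributes the
   empty set. *)
have -> : (fun w => (f w, g w)) @^-1` U =
    \bigcup_p [set w | box p `<=` U /\ box p (f w, g w)].
  apply/seteqP; split => [w /= Uw|w [p _ /= [pU]]]; last by move=> /pU.
  have [e /= e0 eU] : nbhs_ball (f w, g w) U.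
    by apply/nbhs_ballP; exact: open_nbhs_nbhs.
  have [k rk] : exists k, 0 + r k < e / 2.
    by apply: ltr_add_invr; rewrite divr_gt0.
  have rk0 : 0 < r k by rewrite /r invr_gt0.
  have [a [wa Da]] : ball (f w) (r k) `&` D !=set0.
    by apply: dD; [exists (f w); exact: ballxx|exact: ball_open].
  have [b [wb Db]] : ball (g w) (r k) `&` D' !=set0.
    by apply: dD'; [exists (g w); exact: ballxx|exact: ball_open].
  exists (SigSub (mem_set Da), SigSub (mem_set Db), k) => //=.
  have re : r k + r k <= e by lra.
  split; last by split; exact: ball_sym.
  move=> [x y] [/= ax bx]; apply: eU; split => /=.
  - exact: le_ball re _ (ball_triangle wa ax).
  - exact: le_ball re _ (ball_triangle wb bx).
apply: countable_bigcupT_measurable => [|p].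
  rewrite -setXTT -setXTT; apply: countableX => //; apply: countableX.
  - by rewrite (eq_countable (card_setT _)).
  - by rewrite (eq_countable (card_setT _)).
have [pU|npU] := pselect (box p `<=` U); last first.
  by rewrite (_ : [set _ | _] = set0)//; apply/seteqP; split => // w [].
rewrite (_ : [set _ | _] =
    (fun w => `|f w - \val p.1.1|) @^-1` `]-oo, r p.2[ `&`
    (fun w => `|g w - \val p.1.2|) @^-1` `]-oo, r p.2[); last first.
  apply/seteqP; split => w /=; rewrite !in_itv/= => -[].
    by rewrite /box -!ball_normE /= => _ []; rewrite !(distrC (sval _)).
  by split=> //; rewrite /box -!ball_normE /= !(distrC (sval _)).
apply: measurableI; rewrite -[X in measurable X]setTI.
- by apply: mf => //; exact: measurable_itv.
- by apply: mg => //; exact: measurable_itv.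
Qed.

Section gaussian_functional.
Context (R : realType) (H : completeNormedModType R) (dot : H -> H -> R).
Context (Hdot : hilbert dot) (A S : H -> H) (HS : is_sqrt dot A S).
Context (mu : probability (borel H) R) (Hmu : gaussian_measure dot mu 0 A).

(** Since [S] is symmetric and [S \o S = A], the variance [<A k, k>] is [|S k|^2]. *)
Lemma gaussian_functional_law k (B : set R) : measurable B ->
  mu [set x | B (dot x k)] =
  if `|S k| == 0 then \d_(0 : R) B else normal_prob 0 `|S k| B.
Proof.
move=> mB; apply: etrans (Hmu.2 k B mB) _.
rewrite (dot0l Hdot) /normal_law.
have [_ [symS _] <-] := HS; rewrite /= symS (dotxx Hdot).
by rewrite sqrf_eq0 sqrtr_sqr normr_id.
Qed.

Lemma measurable_functional k : measurable_fun [set: borel H] (dot ^~ k).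
Proof.
by apply: continuous_borel_measurable; exact: continuous_dotl Hdot k.
Qed.

(** Dividing [k] by [|S k|] reduces to variance 1; if [S k = 0] the functional vanishes almost
    surely. The second moment of N(0, 1) stays symbolic, as its finiteness is enough for the
    convergence estimates. *)
Lemma gaussian_functional_moment2 k :
  (\int[mu]_x (dot x k ^+ 2)%:E =
   (`|S k| ^+ 2)%:E * \int[@normal_prob R 0 1]_x (x ^+ 2)%:E)%E.
Proof.
have mk h : measurable_fun [set: borel H] (fun x => (dot x h ^+ 2)%:E).
  by apply/measurable_EFinP/measurable_funX; exact: measurable_functional.
have [linS _] : bounded_operator S by case: HS.
have [Sk0|Sk0] := eqVneq `|S k| 0.
  rewrite Sk0 expr0n mul0e; apply/eqP; rewrite -(integral0 mu setT); apply/eqP.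
  apply: ae_eq_integral => //.
  exists [set x | (dot x k != 0)]; split.
  - have -> : [set x | dot x k != 0] = [set x | [set~ (0 : R)] (dot x k)].
      by apply/seteqP; split=> x /eqP.
    rewrite -[X in measurable X]setTI.
    apply: (measurable_functional k measurableT (Y := [set~ (0 : R)])).
    exact: measurableC.
  - have -> : [set x | dot x k != 0] = [set x | [set~ (0 : R)] (dot x k)].
      by apply/seteqP; split=> x /eqP.
    have m0 := measurableC (measurable_set1 (0 : R)).
    apply: etrans (gaussian_functional_law k m0) _.
    by rewrite Sk0 eqxx diracE memNset//=; exact.
  - move=> x /=; apply: contra_notP => /negP; rewrite negbK => /eqP ->.
    by rewrite expr0n.
pose h := `|S k|^-1 *: k.
have Sh : `|S h| = 1.
  by rewrite /h (linear_funZ linS) normrZ normfV normr_id mulVf.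
pose mF := isMeasurableFun.Build _ _ (borel H) (measurableTypeR R) _
  (measurable_functional h).
pose F : {mfun borel H >-> measurableTypeR R} := HB.pack (dot ^~ h) mF.
have <- : (\int[mu]_x (dot x h ^+ 2)%:E =
           \int[@normal_prob R 0 1]_x (x ^+ 2)%:E)%E.
  have mx2 : measurable_fun [set: R] (fun x : R => (x ^+ 2)%:E).
    by apply/measurable_EFinP; exact: measurable_funX.
  have := @ge0_integral_distribution _ _ _ _ _ mu F (fun x => (x ^+ 2)%:E) mx2.
  move=> <-; last by move=> y; rewrite /= lee_fin sqr_ge0.
  apply: eq_measure_integral => B mB _.
  transitivity (mu [set x | B (dot x h)]) => //.
  by rewrite gaussian_functional_law// Sh oner_eq0.
rewrite -ge0_integralZl//; last by move=> x _; rewrite lee_fin sqr_ge0.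
apply: eq_integral => x _; rewrite -EFinM /h (dotZr Hdot); congr EFin.
by rewrite exprMn exprVn mulrA mulfV ?mul1r// sqrf_eq0.
Qed.

End gaussian_functional.

(** * Finite-rank approximation *)

(** The integrals add up to at most [c], so by monotone convergence the sum of the series is
    integrable, hence finite almost everywhere. *)
Lemma ae_bounded_partial_sums (R : realType) d (T : measurableType d)
    (mu : {measure set T -> \bar R}) (u : nat -> T -> R) (c : R) :
  (forall n, measurable_fun setT (u n)) -> (forall n x, 0 <= u n x) ->
  0 <= c -> (forall n, \int[mu]_x (u n x)%:E <= (c / (2 ^ n.+1)%:R)%:E)%E ->
  {ae mu, forall x, exists C, forall k, \sum_(0 <= n < k) u n x <= C}.
Proof.
move=> mu_ u0 c0 uc.
have mE n : measurable_fun setT (EFin \o u n) by exact/measurable_EFinP.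
have u0E n x : (0 <= (u n x)%:E)%E by rewrite lee_fin.
pose f : T -> \bar R := fun x => (\sum_(0 <= n <oo) (u n x)%:E)%E.
have f0 x : (0 <= f x)%E by apply: nneseries_ge0.
have fint : mu.-integrable setT f.
  apply/integrableP; split.
    apply: (@ge0_emeasurable_sum _ _ _ _ (fun n x => (u n x)%:E) xpredT).
      by move=> n x _ _; exact: u0E.
    by move=> n _; exact: mE.
  under eq_integral do rewrite gee0_abs//.
  rewrite integral_nneseries//.
  apply: le_lt_trans (ltry c); apply: le_trans (epsilon_trick0 xpredT c0).
  by apply: lee_nneseries => [n _ _|n _]; [apply: integral_ge0|exact: uc].
have := integrable_ae measurableT fint; apply: filterS => x /(_ I) fx.
exists (fine (f x)) => k; rewrite -lee_fin fineK// -sumEFin.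
exact: nneseries_lim_ge.
Qed.

Section half_powers.
Context (R : realType).

(** The shifted exponent makes the whole series sum to 1 and matches the bound in
    [ae_bounded_partial_sums]. *)
Definition half_power (n : nat) : R := (2 ^ n.+1)%:R^-1.

Lemma half_power_gt0 n : 0 < half_power n.
Proof. by rewrite invr_gt0 ltr0n expn_gt0. Qed.

Lemma half_powerS n : half_power n.+1 = half_power n / 2.
Proof. by rewrite /half_power expnSr natrM invfM. Qed.

Lemma sum_half_power n : \sum_(0 <= i < n) half_power i <= 1.
Proof.
suff : \sum_(0 <= i < n) half_power i = 1 - 2 * half_power n.
  by move=> ->; have := half_power_gt0 n; lra.
elim: n => [|n IH]; first by rewrite big_geq// /half_power expn1 mulfV ?subrr.
by rewrite big_nat_recr//= IH half_powerS; field.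
Qed.

Lemma half_power_le1 n : half_power n <= 1.
Proof. by rewrite invf_le1 ?ltr0n ?expn_gt0// ler1n expn_gt0. Qed.

Lemma half_power_cvg : half_power @ \oo --> 0.
Proof.
apply/cvgrPdist_lt => eps eps0; near=> n.
rewrite sub0r normrN ger0_norm ?ltW ?half_power_gt0//.
apply: (@le_lt_trans _ _ n.+1%:R^-1).
  rewrite /half_power lef_pV2 ?posrE ?ltr0n ?expn_gt0//.
  by rewrite ler_nat ltnW// ltn_expl.
near: n; exact: near_infty_natSinv_lt (PosNum eps0).
Unshelve. all: by end_near. Qed.

End half_powers.

(** Half of [eps] pays for the tail of [sum_i |w i|^2] beyond [N], where [g] is zero; the other half
    is shared among the first [N] approximations. *)
Lemma approximation_finite (R : realType) (H : normedModType R) (S : H -> H)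
    (w : nat -> H) (C eps : R) :
  S 0 = 0 ->
  (forall i eta, 0 < eta -> exists g, `|w i - S g| < eta) ->
  (forall n, \sum_(0 <= i < n) `|w i| ^+ 2 <= C) ->
  0 < eps ->
  exists (g : nat -> H) (N : nat), (forall i, (N <= i)%N -> g i = 0) /\
    forall M, \sum_(0 <= i < M) `|S (g i) - w i| ^+ 2 <= eps.
Proof.
move=> S0 dw wC eps0; pose s n := \sum_(0 <= i < n) `|w i| ^+ 2.
have ns : nondecreasing_seq s.
  by apply/nondecreasing_seqP => n; rewrite /s big_nat_recr//= lerDl sqr_ge0.
have sc : cvgn s.
  by apply: nondecreasing_is_cvgn => //; exists C => _ [n _ <-]; exact: wC.
have : \forall n \near \oo, `|limn s - s n| < eps / 2.
  by apply: cvgr_dist_lt => //; rewrite divr_gt0.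
move=> [N _ /(_ N (leqnn N))/= sN].
(* Dividing by [N.+1] instead of [N] keeps the share meaningful when [N = 0]. *)
have eta0 : 0 < eps / (2 * N.+1%:R) by rewrite divr_gt0// mulr_gt0.
have /choice[g gP] : forall i, exists g,
    `|w i - S g| < Num.sqrt (eps / (2 * N.+1%:R)).
  by move=> i; apply: dw; rewrite sqrtr_gt0.
pose h i := if (i < N)%N then g i else 0.
exists h, N; split=> [i Ni|M]; first by rewrite /h ltnNge Ni.
(* Enlarging [M] to at least [N] allows the sum to be split at [N]. *)
pose M' := maxn N M; pose t i := `|S (h i) - w i| ^+ 2.
change (\sum_(0 <= i < M) t i <= eps).
have t0 i : 0 <= t i by exact: sqr_ge0.
have : \sum_(0 <= i < M) t i <= \sum_(0 <= i < M') t i.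
  by rewrite (big_cat_nat (n := M) (p := M'))//= ?leq_maxr// lerDl sumr_ge0.
move=> /le_trans; apply.
rewrite (big_cat_nat (n := N) (p := M'))//= ?leq_maxl//.
have : \sum_(N <= i < M') t i <= eps / 2.
  have -> : \sum_(N <= i < M') t i = s M' - s N.
    rewrite /s (big_cat_nat (m := 0%N) (n := N) (p := M'))//= ?leq_maxl//.
    rewrite [RHS]addrC addKr.
    apply: eq_big_nat => i /andP[Ni _].
    by rewrite /t /h ltnNge Ni/= S0 sub0r normrN.
  have := nondecreasing_cvgn_le ns sc M'; have := ler_norm (limn s - s N).
  lra.
have : \sum_(0 <= i < N) t i <= eps / 2.
  apply: (@le_trans _ _ (\sum_(0 <= i < N) eps / (2 * N.+1%:R))).
    apply: ler_sum_nat => i /andP[_ iN].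
    rewrite /t /h iN distrC -[leRHS](sqr_sqrtr (ltW eta0)).
    by rewrite ler_sqr ?nnegrE ?sqrtr_ge0// ltW// gP.
  rewrite sumr_const_nat subn0 -[_ *+ N]mulr_natr.
  have -> : eps / 2 = eps / (2 * N.+1%:R) * N.+1%:R.
    by rewrite invfM mulrA -mulrA mulVf ?mulr1.
  by rewrite ler_wpM2l ?ler_nat// ltW.
lra.
Qed.

(** * Domain and measurability of pointwise limits of operators *)

Section continuous_sequence.
Context (R : realType) (H : completeNormedModType R) (f : nat -> H -> H).

Lemma cvg_domain_linear : (forall n, linear (f n)) ->
  linear_on [set x | cvgn (f ^~ x)] (fun x => limn (f ^~ x)).
Proof.
move=> linf.
have key (a : R) x y : cvgn (f ^~ x) -> cvgn (f ^~ y) ->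
    f n (a *: x + y) @[n --> \oo] --> a *: limn (f ^~ x) + limn (f ^~ y).
  move=> cx cy; under eq_fun do rewrite linf.
  by apply: cvgD => //; apply: cvgZr.
split; first split.
- rewrite /=; under eq_fun do rewrite (linear_fun0 (linf _)).
  exact: is_cvg_cst.
- by move=> a x y cx cy /=; apply/cvg_ex; eexists; exact: key.
- by move=> a x y cx cy; apply: cvg_lim => //; exact: key.
Qed.

(** By completeness the domain is the set where the Cauchy criterion holds; with tolerances
    [1 / (k + 1)] this is a countable combination of closed sets. *)
Lemma measurable_cvg_domain : (forall n, continuous (f n)) ->
  measurable ([set x | cvgn (f ^~ x)] : set (borel H)).
Proof.
move=> cf.
pose C (k N n : nat) := [set x | `|f n x - f N x| <= k.+1%:R^-1].
have -> : [set x | cvgn (f ^~ x)] =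
    \bigcap_k \bigcup_N \bigcap_n C k N (N + n)%N.
  apply/seteqP; split => [x /= cx k _|x /= xC].
    have k0 : 0 < k.+1%:R^-1 / 2 :> R by rewrite divr_gt0.
    have [N _ fN] : \forall n \near \oo,
        `|limn (f ^~ x) - f n x| <= k.+1%:R^-1 / 2 by exact: cvgr_dist_le.
    exists N => // n _; rewrite /C /=.
    have := fN _ (leqnn N); have := fN _ (leq_addr n N) => /= h1 h2.
    have := ler_distD (limn (f ^~ x)) (f (N + n)%N x) (f N x).
    rewrite (distrC (f (N + n)%N x) (limn _)) => h.
    by apply: le_trans h _; rewrite [leRHS]splitr lerD.
  apply/cauchy_cvgP/cauchyP => eps eps0.
  have [k] := ltr_add_invr eps0; rewrite add0r => keps.
  have [N _ CN] := xC k I; exists (f N x), N => // n /= Nn.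
  rewrite -ball_normE/= distrC; apply: le_lt_trans keps.
  by have := CN (n - N)%N I; rewrite /C /= subnKC.
apply: bigcapT_measurable => k; apply: bigcupT_measurable => N.
apply: bigcapT_measurable => n; apply: closed_borel.
rewrite (_ : C _ _ _ = (fun x => `|f (N + n)%N x - f N x|) @^-1`
  [set t | t <= k.+1%:R^-1]) //.
apply: closed_comp; last exact: closed_le.
by move=> x _; apply: cvg_norm; apply: cvgB; exact: cf.
Qed.

Lemma measurable_on_cvg_domain (phi : H -> R) :
  (forall n, continuous (f n)) -> continuous phi ->
  measurable_fun [set: borel H] (fun x =>
    phi (on_domain [set x | cvgn (f ^~ x)] (fun x => limn (f ^~ x)) x)).
Proof.
move=> cf cphi; set V := [set x | _].
have mV : measurable (V : set (borel H)) by exact: measurable_cvg_domain.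
(* Off [V] the term [phi 0] reproduces the default value 0 of [on_domain], so [h n] converges
   everywhere. *)
pose h n x : R := \1_V x * phi (f n x) + (1 - \1_V x) * phi 0.
apply: (@measurable_fun_cvg _ (borel H) _ setT h) => [n|x _].
  have m1 : measurable_fun [set: borel H] (\1_V : H -> R).
    exact: measurable_indic.
  apply: measurable_funD; apply: measurable_funM => //.
    apply: continuous_borel_measurable => x.
    exact: (cvg_comp (f n) phi (cf n x) (cphi (f n x))).
  exact: measurable_funB.
rewrite /h /on_domain indicE; case: ifPn => [/set_mem Vx|_] /=.
  under eq_fun do rewrite mul1r subrr mul0r addr0.
  exact: (cvg_comp (f ^~ x) phi Vx (cphi _)).
by under eq_fun do rewrite mul0r subr0 mul1r add0r; exact: cvg_cst.
Qed.

End continuous_sequence.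

(** * The finite-rank operators: deterministic estimates *)

Section approximation.
Context (R : realType) (H : completeNormedModType R) (dot : H -> H -> R).
Context (Hdot : hilbert dot) (e : nat -> H) (He : orthonormal_basis dot e).
Context (S K Ka : H -> H) (linS : linear S).
Context (KKa : forall x y, dot (K x) y = dot x (Ka y)).
Context (symS : forall x y, dot (S x) y = dot x (S y)).
Context (g : nat -> nat -> H) (N : nat -> nat).
Context (gN : forall n i, (N n <= i)%N -> g n i = 0).
Context (gK : forall n M,
  \sum_(0 <= i < M) `|S (g n i) - Ka (e i)| ^+ 2 <= half_power R n ^+ 2).

Definition rank_approx n x := \sum_(0 <= i < N n) dot x (g n i) *: e i.

(** Padding with zero terms lets operators of different ranks be compared over one index range. *)
Lemma approxE n M x : (N n <= M)%N ->
  rank_approx n x = \sum_(0 <= i < M) dot x (g n i) *: e i.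
Proof.
move=> nM; rewrite (big_cat_nat (leq0n _) nM)/=.
rewrite [X in _ + X]big_nat_cond [X in _ + X]big1 ?addr0//.
by move=> i /andP[/andP[Ni _] _]; rewrite gN// (dot0r Hdot) scale0r.
Qed.

Lemma approx_linear n : linear (rank_approx n).
Proof.
move=> a x y; rewrite /rank_approx scaler_sumr -big_split/=.
by apply: eq_bigr => i _; rewrite (dotP Hdot) scalerDl scalerA.
Qed.

Lemma approx_continuous n : continuous (rank_approx n).
Proof.
move=> x; apply: cvg_big => [|i _]; first exact: add_continuous.
by apply: cvgZl; exact: continuous_dotl Hdot _ x.
Qed.

(** The coordinates of the difference are [<h, S (g n i) - Ka (e i)>]. Cauchy-Schwarz and [gK] bound
    the sum of their squares, first with [K h] truncated and then in the limit. *)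
Lemma approx_range_le n h :
  `|rank_approx n (S h) - K h| ^+ 2 <= `|h| ^+ 2 * half_power R n ^+ 2.
Proof.
have hM M : (N n <= M)%N ->
    `|rank_approx n (S h) - \sum_(0 <= i < M) dot (K h) (e i) *: e i| ^+ 2 <=
    `|h| ^+ 2 * half_power R n ^+ 2.
  move=> nM; rewrite (approxE _ nM) -sumrB.
  under eq_bigr do rewrite symS KKa -scalerBl -(dotBr Hdot).
  rewrite (sqr_norm_sum_orthonormal Hdot He).
  apply: le_trans (ler_wpM2l (sqr_ge0 _) (gK n M)).
  rewrite mulr_sumr; apply: ler_sum => i _.
  rewrite -exprMn -real_normK ?num_real//.
  by rewrite ler_sqr ?nnegrE ?mulr_ge0// (cauchy_schwarz Hdot).
(* The shift by [N n] makes every truncation long enough for [hM]. *)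
apply: (@cvg_le_all _ (fun k => `|rank_approx n (S h) -
    \sum_(0 <= i < k + N n) dot (K h) (e i) *: e i| ^+ 2));
  last by move=> k; apply: hM; exact: leq_addl.
apply: cvg_sqr_norm; apply: cvgB; first exact: cvg_cst.
have /(_ (K h)) := He.2.
by rewrite -(cvg_shiftn (N n)).
Qed.

Lemma approx_range_cvg h : rank_approx n (S h) @[n --> \oo] --> K h.
Proof.
apply/cvgrPdist_le => eps eps0.
have : \forall n \near \oo, `|0 - `|h| * half_power R n| <= eps.
  apply: cvgr_dist_le => //; rewrite -(mulr0 `|h|); apply: cvgMr => //.
  exact: half_power_cvg.
apply: filterS => n; rewrite sub0r normrN => /(le_trans _); apply.
rewrite distrC ger0_norm; last by rewrite mulr_ge0// ltW// half_power_gt0.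
rewrite -ler_sqr ?nnegrE ?mulr_ge0// ?(ltW (half_power_gt0 _ _))// exprMn.
exact: approx_range_le.
Qed.

(** Duality with [approx_range_le]: the vector [v] is the adjoint of [rank_approx n \o S - K]
    applied to [h], so [|v|^2] is the pairing of that operator at [v] with [h], and one factor [|v|]
    cancels. *)
Lemma approx_functional_le n h :
  `|S (\sum_(0 <= i < N n) dot h (e i) *: g n i) - Ka h| <=
  half_power R n * `|h|.
Proof.
set k := \sum_(_ <= _ < _) _; set v := _ - _.
have [->|v0] := eqVneq v 0.
  by rewrite normr0 mulr_ge0// ltW// half_power_gt0.
rewrite -(ler_pM2l (_ : 0 < `|v|)) ?normr_gt0// -expr2 -(dotxx Hdot).
have -> : dot v v = dot (rank_approx n (S v) - K v) h.
  rewrite {2}/v (dotBr Hdot) -symS -KKa (dotBl Hdot); congr (_ - _).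
  rewrite /k (dot_sumr Hdot) (dot_suml Hdot); apply: eq_bigr => i _.
  by rewrite (dotZr Hdot) (dotZl Hdot) mulrC (dotC Hdot h).
apply: le_trans (ler_norm _) _; apply: le_trans (cauchy_schwarz Hdot _ _) _.
rewrite mulrA ler_wpM2r//.
rewrite -ler_sqr ?nnegrE ?mulr_ge0// ?(ltW (half_power_gt0 _ _))// exprMn.
exact: approx_range_le.
Qed.

(** This turns a coordinate of [rank_approx n x] into a functional of [x], whose Gaussian law is
    known. *)
Lemma approx_functional n x h :
  dot (rank_approx n x) h = dot x (\sum_(0 <= i < N n) dot h (e i) *: g n i).
Proof.
rewrite (dot_sumr Hdot) (dot_suml Hdot); apply: eq_bigr => i _.
by rewrite (dotZr Hdot) (dotZl Hdot) mulrC (dotC Hdot h).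
Qed.

(** * Almost sure convergence and limit laws under N(0, A) *)

Section gaussian.
Context (A : H -> H) (HS : is_sqrt dot A S).
Context (mu : probability (borel H) R) (Hmu : gaussian_measure dot mu 0 A).

Let m2 := fine (\int[@normal_prob R 0 1]_x (x ^+ 2)%:E)%E.

Let m2_ge0 : 0 <= m2.
Proof.
by apply: fine_ge0; apply: integral_ge0 => x _; rewrite lee_fin sqr_ge0.
Qed.

Lemma gaussian_moment2 k :
  (\int[mu]_x (dot x k ^+ 2)%:E)%E = (`|S k| ^+ 2 * m2)%:E.
Proof.
rewrite (gaussian_functional_moment2 Hdot HS Hmu) [RHS]EFinM /m2 fineK//.
rewrite ge0_fin_numE; first exact: normal_moment2_lty.
by apply: integral_ge0 => x _; rewrite lee_fin sqr_ge0.
Qed.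

Lemma approx_increment_moment2 n :
  (\int[mu]_x (`|rank_approx n.+1 x - rank_approx n x| ^+ 2)%:E <=
   (4 * half_power R n ^+ 2 * m2)%:E)%E.
Proof.
pose M := maxn (N n.+1) (N n).
have mf k : measurable_fun [set: borel H] (fun x => (dot x k ^+ 2)%:E).
  by apply/measurable_EFinP/measurable_funX; exact: measurable_functional.
rewrite (eq_integral (fun x : borel H =>
    \sum_(0 <= i < M) (dot x (g n.+1 i - g n i) ^+ 2)%:E)%E); last first.
  move=> x _; rewrite sumEFin; congr EFin.
  rewrite (@approxE n.+1 M) ?leq_maxl// (@approxE n M) ?leq_maxr// -sumrB.
  under eq_bigr do rewrite -scalerBl -(dotBr Hdot).
  by rewrite (sqr_norm_sum_orthonormal Hdot He).
rewrite ge0_integral_sum//; last by move=> i x _; rewrite lee_fin sqr_ge0.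
under eq_bigr do rewrite gaussian_moment2.
rewrite sumEFin lee_fin -mulr_suml ler_wpM2r//.
(* Both approximations are compared with their common target [Ka (e i)]; each half then costs at
   most [2 * half_power n ^+ 2], whence the constant 4. *)
apply: (@le_trans _ _ (\sum_(0 <= i < M) (2 * `|S (g n.+1 i) - Ka (e i)| ^+ 2 +
    2 * `|S (g n i) - Ka (e i)| ^+ 2))).
  apply: ler_sum => i _; rewrite (linear_funB linS).
  rewrite -[X in `|X|](subrKA (Ka (e i))) -[X in _ + X]opprB.
  by apply: le_trans (sqr_norm_add_le Hdot _ _) _; rewrite normrN.
rewrite big_split/= -!mulr_sumr.
have -> : 4 * half_power R n ^+ 2 =
    2 * half_power R n ^+ 2 + 2 * half_power R n ^+ 2 by ring.
apply: lerD; rewrite ler_pM2l//; apply: le_trans (gK _ M) _ => //.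
rewrite half_powerS exprMn ler_piMr ?sqr_ge0// expr_le1//; lra.
Qed.

(** The squared increments have moments of order [4^-(n+1)], so they remain summable after
    multiplication by [2^(n+1)]. Finiteness of this weighted sum makes the increments absolutely
    summable. *)
Lemma ae_cvg_approx : {ae mu, forall x, cvgn (rank_approx ^~ x)}.
Proof.
pose D n x := rank_approx n.+1 x - rank_approx n x.
have mD n : measurable_fun [set: borel H] (fun x => `|D n x| ^+ 2).
  apply: continuous_borel_measurable => x; apply: cvg_sqr_norm.
  by apply: cvgB; exact: approx_continuous.
have half_ge0 n : 0 <= half_power R n by rewrite ltW// half_power_gt0.
pose u n x := (half_power R n)^-1 * `|D n x| ^+ 2.
have : {ae mu, forall x, exists C, forall k, \sum_(0 <= n < k) u n x <= C}.
  apply: (@ae_bounded_partial_sums _ _ _ _ _ (4 * m2)).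
  - by move=> n; apply: measurable_funM => //; exact: mD.
  - by move=> n x; rewrite mulr_ge0// ?invr_ge0 ?sqr_ge0.
  - by rewrite mulr_ge0.
  - move=> n; under eq_integral do rewrite /u EFinM.
    rewrite ge0_integralZl//.
    + apply: (@le_trans _ _ ((half_power R n)^-1%:E *
        (4 * half_power R n ^+ 2 * m2)%:E)%E).
        by rewrite lee_pmul2l// ?lte_fin ?invr_gt0 ?half_power_gt0//
          approx_increment_moment2.
      rewrite -EFinM lee_fin -/(half_power R n) le_eqVlt; apply/orP; left.
      by apply/eqP; field; rewrite gt_eqF ?half_power_gt0.
    + by apply/measurable_EFinP; exact: mD.
    + by rewrite lee_fin invr_ge0.
apply: (@filterS _ _ (ae_filter_ringOfSetsType mu)) => x [C xC].
  have Dx : cvgn (series (D ^~ x)).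
    apply: normed_cvg; apply: nondecreasing_is_cvgn.
      apply/nondecreasing_seqP => n.
      by rewrite /normed_series_of /series/= big_nat_recr//= lerDl.
    exists (1 + C) => _ [n _ <-].
    rewrite /normed_series_of /series/=.
    apply: le_trans (lerD (sum_half_power R n) (xC n)).
    rewrite -big_split/=; apply: ler_sum => i _; rewrite /u.
    (* AM-GM: [t <= h + t^2 / h] *)
    have h0 := half_power_gt0 R i; move: (half_power R i) h0 => h h0.
    rewrite -(ler_pM2l h0) mulrDr mulrA mulfV ?gt_eqF// mul1r.
    by have := normr_ge0 (D i x); have := sqr_ge0 (h - `|D i x|); nra.
  have -> : rank_approx ^~ x = (fun n => rank_approx 0 x + series (D ^~ x) n).
    apply/funext => n; rewrite /series/= /D telescope_sumr//.
    by rewrite addrC subrK.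
  by apply: is_cvgD => //; exact: is_cvg_cst.
Qed.

(** The functionals [<x, k n>] have standard deviations [|S (k n)|] tending to [|q|]. The cases of
    zero and nonzero [q] are separated because the limit is a point mass in the first and has a
    density in the second. *)
Lemma gaussian_limit_law h1 h2 (f : borel H -> R) :
  measurable_fun setT f ->
  {ae mu, forall x, dot (rank_approx n x) h1 + dot x h2 @[n --> \oo] --> f x} ->
  forall B : set R, measurable B ->
  mu (f @^-1` B) = if `|Ka h1 + S h2| == 0 then \d_(0 : R) B
                   else normal_prob 0 `|Ka h1 + S h2| B.
Proof.
move=> mf fcvg; set q := Ka h1 + S h2.
pose k n := \sum_(0 <= i < N n) dot h1 (e i) *: g n i + h2.
have kE n x : dot (rank_approx n x) h1 + dot x h2 = dot x (k n).
  by rewrite approx_functional -(dotDr Hdot).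
have Skq n : `|S (k n) - q| <= half_power R n * `|h1|.
  rewrite (linear_funD linS) /q opprD addrACA subrr addr0.
  exact: approx_functional_le.
have {}fcvg : {ae mu, forall x, dot x (k n) @[n --> \oo] --> f x}.
  apply: (@filterS _ _ (ae_filter_ringOfSetsType mu)) fcvg => x.
  by under eq_fun do rewrite kE.
have mk h : measurable_fun [set: borel H] (dot ^~ h).
  exact: measurable_functional.
have [q0|q0] := eqVneq `|q| 0.
  (* When [q = 0] the moments of [u n] are summable, so [u n x] tends to 0 almost surely and [f]
     vanishes almost surely; the constant sequence 0 then identifies its law. *)
  pose u n x := dot x (k n) ^+ 2.
  have ub : {ae mu, forall x, exists C, forall m, \sum_(0 <= n < m) u n x <= C}.
    apply: (@ae_bounded_partial_sums _ _ _ _ _ (`|h1| ^+ 2 * m2)).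
    - by move=> n; apply: measurable_funX; exact: mk.
    - by move=> n x; exact: sqr_ge0.
    - by rewrite mulr_ge0 ?sqr_ge0.
    - move=> n; rewrite /u gaussian_moment2 lee_fin [leRHS]mulrAC ler_wpM2r//.
      have := Skq n; rewrite (normr0_eq0 q0) subr0 => Skn.
      apply: (@le_trans _ _ ((half_power R n * `|h1|) ^+ 2)).
        by rewrite ler_sqr ?nnegrE// mulr_ge0// ltW// half_power_gt0.
      rewrite exprMn mulrC ler_wpM2l ?sqr_ge0// expr2.
      rewrite ler_piMl ?half_power_le1//.
      by rewrite ltW// half_power_gt0.
  pose nu : probability (measurableTypeR R) R := \d_(0 : measurableTypeR R).
  apply: (@eq_distribution_cvg _ _ _ mu nu (fun _ => cst 0) f) => //.
    apply: (@filterS2 _ _ (ae_filter_ringOfSetsType mu)) fcvg ub => x fx [C uC].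
    have uc : cvgn (series (u ^~ x)).
      apply: nondecreasing_is_cvgn; last by exists C => _ [m _ <-]; exact: uC.
      apply/nondecreasing_seqP => m.
      by rewrite /series/= big_nat_recr//= lerDl sqr_ge0.
    have u0 := cvg_series_cvg_0 uc.
    have uf : u n x @[n --> \oo] --> f x ^+ 2.
      exact: (cvg_comp _ (fun t : R => t ^+ 2) fx (@exprn_continuous R 2 _)).
    have /esym/eqP : 0 = f x ^+ 2 by exact: (cvg_unique (@Rhausdorff R) u0 uf).
    by rewrite sqrf_eq0 => /eqP ->; exact: cvg_cst.
  move=> _ B mB; transitivity (\d_(0 : R) B : \bar R) => //.
  rewrite preimage_cst diracE.
  by case: ifPn => _; rewrite ?probability_setT ?measure0.
have Skcvg : `|S (k n)| @[n --> \oo] --> `|q|.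
  apply: cvg_norm; apply/cvgrPdist_le => eps eps0.
  have : \forall n \near \oo, `|0 - half_power R n * `|h1| | <= eps.
    apply: cvgr_dist_le => //; rewrite -(mul0r `|h1|); apply: cvgMl.
    exact: half_power_cvg.
  apply: filterS => n; rewrite sub0r normrN => /(le_trans _); apply.
  by rewrite distrC; apply: le_trans (Skq n) (ler_norm _).
(* Rescaling [k n] makes the approximating variables have exactly the law
   N(0, |q|^2). *)
have [M _ SkM] : \forall n \near \oo, `|S (k n)| != 0.
  exact: cvgr_neq0 Skcvg q0.
pose c n := `|q| / `|S (k (n + M)%N)|.
have ccvg : c n @[n --> \oo] --> (1 : R).
  rewrite -(mulfV q0); apply: cvgM; first exact: cvg_cst.
  apply: cvgV => //.
  by rewrite (cvg_shiftn M (fun n => `|S (k n)|)).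
apply: (@eq_distribution_cvg _ _ _ mu (normal_prob 0 `|q|)
  (fun n => dot ^~ (c n *: k (n + M)%N))) => //.
  apply: (@filterS _ _ (ae_filter_ringOfSetsType mu)) fcvg => x fx.
  under eq_fun do rewrite (dotZr Hdot).
  rewrite -[f x]mul1r; apply: cvgM => //.
  by rewrite (cvg_shiftn M (fun n => dot x (k n))).
move=> n B mB.
apply: etrans (gaussian_functional_law Hdot HS Hmu (c n *: k (n + M)%N) mB) _.
have Sk0 := SkM (n + M)%N (leq_addl _ _).
have -> : `|S (c n *: k (n + M)%N)| = `|q|.
  rewrite (linear_funZ linS) normrZ /c normrM normrV ?unitfE// !normr_id.
  by rewrite divfK.
by rewrite (negbTE q0).
Qed.

End gaussian.
End approximation.

(** The choice in [adj] is harmless because the inner product separates points: any vector with the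
    defining property is the chosen one. *)
Lemma adjE (R : realType) (H : completeNormedModType R) (dot : H -> H -> R)
    (F : lmodType R) (dotF : F -> F -> R) (K : H -> F) (y : F) (z : H) :
  hilbert dot -> (forall x, dotF (K x) y = dot x z) -> adj dot dotF K y = z.
Proof.
move=> Hdot Kz; rewrite /adj; case: xgetP => [w _ Kw|/(_ z)//].
by apply: (dot_inj Hdot) => x; rewrite -Kw -Kz.
Qed.

(** * Construction of the extension and law of the pair *)

Unset Implicit Arguments.

Theorem theorem5p5 (R : realType) (H : completeNormedModType R)
  (dot : H -> H -> R) (Hdot : hilbert dot)
  (Hsep : separable H) (Hinf : infinite_dimensional H)
  (A S : H -> H) (T : H -> H)
  (Apsd : positive_semidefinite dot A) (Atr : trace_class dot A)
  (HS : is_sqrt dot A S)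
  (HT : unbounded_operator (closure (range A)) (range S) T)
  (d : measure_display) (Omega : measurableType d) (P : probability Omega R)
  (X : Omega -> H) (HX : gaussian_rv dot P X 0 A)
  (HTS : hilbert_schmidt dot (T \o S)) :
  exists (V : set H) (T' : H -> H),
    [/\ extension V T' (range S) T,
        measurable (V : set (borel H)),
        forall mu : probability (borel H) R,
          gaussian_measure dot mu 0 A -> mu V = 1%E &
        let K : H -> H * H := fun h => (T (S h), S h) in
        gaussian_rv (prod_dot dot dot) P
          (fun w => (on_domain V T' (X w), X w))
          0 (K \o adj dot (prod_dot dot dot) K)].
Proof.
have [[linS contS] [symS _] _] := HS.
have [[linK contK] [e [He Klty]]] := HTS.
set L := T \o S in linK contK Klty.
have [C LC] : exists C, forall n, \sum_(0 <= i < n) `|L (e i)| ^+ 2 <= C.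
  exists (fine (\sum_(0 <= n <oo) (`|L (e n)| ^+ 2)%:E)%E) => n.
  rewrite -lee_fin fineK ?ge0_fin_numE//; last first.
    by apply: nneseries_ge0 => i _ _; rewrite lee_fin sqr_ge0.
  rewrite -sumEFin; apply: nneseries_lim_ge => i _ _.
  by rewrite lee_fin sqr_ge0.
have [La LLa] := hilbert_schmidt_adjoint Hdot He (conj linK contK) LC.
have LaC := hilbert_schmidt_adjoint_le Hdot He LC LLa.
(* If [S x = 0] then [L x = T 0 = L 0 = 0], so [La (e i)] is orthogonal to the kernel of [S]. *)
have La_range i eta : 0 < eta -> exists g, `|La (e i) - S g| < eta.
  apply: (closure_range_symmetric Hdot linS symS) => x Sx.
  rewrite (dotC Hdot) -LLa (_ : L x = 0) ?(dot0l Hdot)//.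
  by rewrite -(linear_fun0 linK) /L /= Sx (linear_fun0 linS).
have /choice[p pP] n : exists p : (nat -> H) * nat,
    (forall i, (p.2 <= i)%N -> p.1 i = 0) /\
    forall M, \sum_(0 <= i < M) `|S (p.1 i) - La (e i)| ^+ 2 <=
      half_power R n ^+ 2.
  have half2 : 0 < half_power R n ^+ 2 by rewrite exprn_gt0// half_power_gt0.
  have [g [N gN]] := approximation_finite (linear_fun0 linS) La_range LaC half2.
  by exists (g, N).
pose g n := (p n).1; pose N n := (p n).2.
have gN n i : (N n <= i)%N -> g n i = 0 by exact: (pP n).1.
have gL n M : \sum_(0 <= i < M) `|S (g n i) - La (e i)| ^+ 2 <=
    half_power R n ^+ 2 by exact: (pP n).2.
pose f := rank_approx dot e g N.
have linf n : linear (f n) by exact: approx_linear.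
have contf n : continuous (f n) by exact: approx_continuous.
have aef (mu : probability (borel H) R) : gaussian_measure dot mu 0 A ->
    {ae mu, forall x, cvgn (f ^~ x)}.
  by move=> Hmu; exact: (ae_cvg_approx Hdot He linS gN gL HS Hmu).
(* The sequence [f] is built from [S] and [L] alone, so one [V] serves every Gaussian [mu]. *)
pose V := [set x | cvgn (f ^~ x)].
have mV : measurable (V : set (borel H)) by exact: measurable_cvg_domain.
exists V, (fun x => limn (f ^~ x)); split => //.
- split; first exact: cvg_domain_linear.
  move=> _ [_ [h _ <-] <-].
  have fL : f n (S h) @[n --> \oo] --> L h by exact: approx_range_cvg.
  exists (S h); first by apply/cvg_ex; exists (L h).
  by congr (_, _); exact: cvg_lim fL.
- move=> mu Hmu; have [Z [mZ Z0 VZ]] := aef mu Hmu.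
  have VC0 : mu (~` V) = 0.
    by apply: (subset_measure0 _ mZ VZ Z0); exact: measurableC.
  by rewrite -[V]setCK probability_setC ?VC0 ?sube0//; exact: measurableC.
- move=> K; have [mX Xlaw] := HX.
  (* This computes the adjoint of [K]; the variance in direction [h] becomes [|La h.1 + S h.2|^2],
     as in [gaussian_limit_law]. *)
  have KE x h : prod_dot dot dot (K x) h = dot x (La h.1 + S h.2).
    by rewrite /prod_dot /= -/(L x) LLa symS (dotDr Hdot).
  have adjK h : adj dot (prod_dot dot dot) K h = La h.1 + S h.2.
    by apply: (adjE Hdot) => x; exact: KE.
  pose mF := isMeasurableFun.Build _ _ Omega (borel H) X HX.1.
  pose XF : {mfun Omega >-> borel H} := HB.pack X mF.
  pose mu : probability (borel H) R := distribution P XF.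
  have Hmu : gaussian_measure dot mu 0 A by [].
  split.
    apply: measurable_borel_pair => // a.
      apply: (@measurableT_comp _ _ _ _ _ _
        (fun x : borel H => `|on_domain V (fun x => limn (f ^~ x)) x - a|)) mX.
      apply: (measurable_on_cvg_domain (phi := fun x => `|x - a|)) => // x.
      by apply: cvg_norm; apply: cvgB => //; exact: cvg_cst.
    apply: (@measurableT_comp _ _ _ _ _ _ (fun x : borel H => `|x - a|)) mX.
    apply: continuous_borel_measurable => x.
    by apply: cvg_norm; apply: cvgB => //; exact: cvg_cst.
  have pdC x y : prod_dot dot dot x y = prod_dot dot dot y x.
    by rewrite /prod_dot !(dotC Hdot x.1) !(dotC Hdot x.2).
  split; first split.
  + by move=> x y; rewrite /= [RHS]pdC !KE !adjK (dotC Hdot).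
  + by move=> x; rewrite /= KE adjK (dotxx Hdot) sqr_ge0.
  move=> h B mB.
  (* The pairing of the random pair with [h] is [F] composed with [X], so its law is computed under
     the law [mu] of [X]. *)
  pose F x := dot (on_domain V (fun x => limn (f ^~ x)) x) h.1 + dot x h.2.
  transitivity (mu (F @^-1` B)) => //.
  apply: etrans (gaussian_limit_law Hdot He linS LLa symS gN gL HS Hmu
    (h1 := h.1) (h2 := h.2) _ _ mB) _.
  + apply: measurable_funD; last exact: measurable_functional.
    apply: (measurable_on_cvg_domain (phi := dot ^~ h.1)) => //.
    exact: continuous_dotl Hdot _.
  + apply: (@filterS _ _ (ae_filter_ringOfSetsType mu)) (aef mu Hmu) => x cx.
    apply: cvgD; last exact: cvg_cst.
    apply: (cvg_dotl Hdot); rewrite /on_domain mem_set //.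
  + rewrite /normal_law [in RHS]/= KE adjK (dotxx Hdot).
    rewrite sqrf_eq0 sqrtr_sqr normr_id.
    by rewrite /prod_dot /= !(dot0l Hdot) addr0.
Qed.
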